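(* Let $p\geq 3$ be a prime, $r$ a positive integer, and $P$ an extraspecial group of order $p^{2r+1}$ and exponent $p$. Let $(\rho,V)$ be an irreducible complex representation of $P$ of degree $p^r$ (which is necessarily faithful), and use $\rho$ to identify $P$ with its image $\rho(P)\subset \mathrm{GL}(V)$. If $G$ is the normalizer of $P$ in $\mathrm{SL}(V)$, then the adjoint representation $\mathrm{Ad}(\rho)$ is an irreducible representation of $G$, i.e. the conjugation action of $G$ on the $(p^{2r}-1)$-dimensional space of trace-zero endomorphisms of $V$ is irreducible.
   Context: A finite $p$-group $P$ is called extraspecial if its center $Z(P)$ is cyclic of order $p$, $Z(P)$ coincides with the commutator subgroup $[P,P]$, and $P/Z(P)$ is elementary abelian. For a group $G\subset \mathrm{GL}(V)$ with $V$ an $n$-dimensional complex vector space, the adjoint representation $\mathrm{Ad}$ is the $(n^2-1)$-dimensional representation of $G$ on the trace-zero endomorphisms $\{M\in\mathrm{End}(V):\mathrm{tr}\,M=0\}$ given by $g\cdot M=gMg^{-1}$. *)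

(* Defs.v *)
From mathcomp Require Import all_boot all_order all_algebra.
From mathcomp Require Import all_fingroup all_solvable all_character.
From mathcomp Require Import complex.
From mathcomp Require Import classical_sets reals.

Set Implicit Arguments.
Unset Strict Implicit.
Unset Printing Implicit Defensive.

Import GRing.Theory.
Local Open Scope ring_scope.
Local Open Scope classical_set_scope.

(* [extraspecial P] requires 'Phi(P) = 'Z(P) and P^`(1) = 'Z(P), with 'Z(P) of
   prime order; for p-groups this is the definition in terms of P / 'Z(P). *)
Lemma extraspecial_pgroupP (p : nat) (gT : finGroupType) (P : {group gT}) :
  prime p -> (p.-group P)%g ->
  extraspecial P <->
    [/\ cyclic 'Z(P)%g, #|'Z(P)%g| = p, 'Z(P)%g = [~: P, P]%g
      & (p.-abelem (P / 'Z(P)))%g].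
Proof.
move=> p_pr pP; split=> [esP | [_ oZ defZ abelPZ]].
  have oZ := card_center_extraspecial pP esP.
  case: esP => -[PhiZ derZ] prZ.
  by split=> //; [exact: prime_cyclic | rewrite -PhiZ; exact: Phi_quotient_abelem].
have nZP : (P \subset 'N('Z(P)))%g by rewrite gFnorm.
split; last by rewrite oZ.
split; last by rewrite defZ.
apply/eqP; rewrite finset.eqEsubset (Phi_min pP nZP abelPZ) /=.
by rewrite {1}defZ (Phi_joing pP) joing_subl.
Qed.

Section MatrixGroups.
Variables (F : fieldType) (n : nat).

Definition SL : set 'M[F]_n := [set g | \det g = 1].

Definition Ad (g M : 'M[F]_n) : 'M[F]_n := g *m M *m invmx g.

Definition normalizer_in (H K : set 'M[F]_n) : set 'M[F]_n :=
  [set g | H g /\ Ad g @` K = K].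

Definition sl : {vspace 'M[F]_n} :=
  lker (linfun (mxtrace : 'M[F]_n -> F^o)).

Lemma mem_sl (M : 'M[F]_n) : (M \in sl) = (\tr M == 0).
Proof. by rewrite memv_ker lfunE. Qed.

Lemma dim_sl : (0 < n)%N -> \dim sl = (n ^ 2 - 1)%N.
Proof.
move=> n_gt0; pose i0 : 'I_n := Ordinal n_gt0; rewrite /sl; set f := linfun _.
have dimM : \dim {: 'M[F]_n} = (n ^ 2)%N by rewrite dimvf /dim /= -mulnn.
have := limg_ker_dim f fullv; rewrite capfv dimM => <-.
suff -> : limg f = fullv by rewrite dimvf /dim /= addnK.
apply/eqP; rewrite eqEsubv subvf /=; apply/subvP => a _.
have -> : a = f (a *: delta_mx i0 i0).
  rewrite lfunE /= mxtraceZ /mxtrace (bigD1 i0) //= mxE !eqxx /=.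
  rewrite big1 ?addr0 ?mulr1 // => i /negPf ii0.
  by rewrite mxE ii0.
by rewrite memv_img ?memvf.
Qed.

End MatrixGroups.

Arguments SL F n : clear implicits.
Arguments sl F n : clear implicits.

Definition stable (F : fieldType) (vT : vectType F) (A : Type) (G : set A)
    (act : A -> vT -> vT) (W : {vspace vT}) : Prop :=
  forall g v, G g -> v \in W -> act g v \in W.

Definition irreducible_on (F : fieldType) (vT : vectType F) (A : Type)
    (G : set A) (act : A -> vT -> vT) (W : {vspace vT}) : Prop :=
  [/\ stable G act W, W <> 0%VS
    & forall U : {vspace vT}, (U <= W)%VS -> stable G act U ->
        U = 0%VS \/ U = W].

Definition repr_image (F : fieldType) (gT : finGroupType) (P : {group gT})
    (n : nat) (rho : mx_representation F P n) : set 'M[F]_n :=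
  [set M | exists2 x, x \in P & M = rho x].

(* Main.v *)
(* Let [W] be a nonzero stable space of trace-zero matrices. The matrices
   [rho x] span all matrices and are eigenvectors of the conjugation by
   [rho(P)], so averaging [W] over [P] against a suitable character yields
   [rho x \in W] for some noncentral [x]. It remains to see that the normalizer
   acts transitively, by conjugation, on the [rho x] with [x] noncentral: these
   span the trace-zero matrices. For [u] in [P] and a central [z] of order [p],
   the Gauss sum [T = \sum_(k < p) rho (z ^ (k choose 2) * u ^ k)] normalizes
   [rho(P)] and acts on [P] modulo its center as a power of the symplectic
   transvection of direction [u]; when [z = [x, u]] it sends [rho x] to
   [rho (u * x)]. It is invertible because its row space is a submodule and its
   trace is nonzero. Two such transvections connect any two noncentral
   elements. Finally, scaling moves normalizing elements into [SL]. *)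

Require Import Defs.
From mathcomp Require Import all_boot all_order all_algebra.
From mathcomp Require Import all_fingroup all_solvable all_character.
From mathcomp Require Import complex.
From mathcomp Require Import classical_sets reals.
From mathcomp Require Import boolp zify.

Set Implicit Arguments.
Unset Strict Implicit.
Unset Printing Implicit Defensive.

Import GRing.Theory Num.Theory Num.Def.
Local Open Scope ring_scope.

(** * Binomial exponents and periodic sums *)

Lemma bin2D (j k : nat) : ('C(j + k, 2) = 'C(j, 2) + j * k + 'C(k, 2))%N.
Proof.
elim: j => [|j IHj]; first by rewrite add0n mul0n.
by rewrite (addSn j k) !binS !bin1 IHj; lia.
Qed.

(** Oddness of [p] enters here: with [bin2D] it makes ['C(k, 2)] modulo [p] periodic in [k] with
    period [p], whereas ['C(2, 2) = 1]. *)
Lemma prime_dvd_bin2 (p : nat) : prime p -> (3 <= p)%N -> (p %| 'C(p, 2))%N.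
Proof. by move=> p_pr p_ge3; rewrite prime_dvd_bin. Qed.

Lemma sum_shift_periodic (V : zmodType) (p : nat) (f : nat -> V) (j : nat) :
    (forall k, f (k + p)%N = f k) ->
  \sum_(k < p) f (k + j)%N = \sum_(k < p) f k.
Proof.
move=> f_per; elim: j => [|j <-]; first by under eq_bigr do rewrite addn0.
case: p f_per => [|p] f_per; first by rewrite !big_ord0.
rewrite big_ord_recr [RHS]big_ord_recl /= addrC add0n.
rewrite -(f_per j) !addnS addnC; congr (_ + _).
by apply: eq_bigr => i _; rewrite addnS.
Qed.

(** * Schur's lemma and the trace form for absolutely irreducible representations *)

Section Representation.

Context {F : fieldType} {gT : finGroupType} {G : {group gT}} {n : nat}.
Context {rG : mx_representation F G n}.

Lemma repr_mx_neq0 x : (0 < n)%N -> x \in G -> rG x != 0.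
Proof.
move=> n_gt0 Gx; apply/eqP=> rGx0; have := repr_mxK rG Gx 1%:M.
move/matrixP/(_ (Ordinal n_gt0) (Ordinal n_gt0))/eqP.
by rewrite rGx0 mulmx0 mul0mx !mxE eqxx eq_sym oner_eq0.
Qed.

Hypothesis absG : mx_absolutely_irreducible rG.

Lemma abs_irr_dim_gt0 : (0 < n)%N.
Proof. by case/andP: absG. Qed.

Lemma center_repr_scalar z : z \in 'Z(G)%g -> exists c, rG z = c%:M.
Proof.
case/centerP=> Gz cGz; apply/is_scalar_mxP/(mx_abs_irr_cent_scalar absG).
by apply/centgmxP=> y Gy; rewrite -!repr_mxM // cGz.
Qed.

(** The [rG x] span all matrices and the trace form is nondegenerate: pairing with [delta_mx j i]
    reads off the entry [M i j]. *)
Lemma abs_irr_trace_eq0 (M : 'M[F]_n) :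
  (forall x, x \in G -> \tr (M *m rG x) = 0) -> M = 0.
Proof.
move=> trM0; have [_ [a aP]] := mx_abs_irrP absG.
have trM A : \tr (M *m A) = 0.
  rewrite (aP A) mulmx_sumr linear_sum big1 //= => x Gx.
  by rewrite -scalemxAr mxtraceZ trM0 ?mulr0.
apply/matrixP=> i j; rewrite mxE -(trM (delta_mx j i)).
rewrite /mxtrace (bigD1 i) //= big1 ?addr0 => [|k /negPf ki]; rewrite !mxE.
  rewrite (bigD1 j) //= mxE !eqxx mulr1 big1 ?addr0 // => l /negPf lj.
  by rewrite mxE lj mulr0.
by rewrite big1 // => l _; rewrite mxE ki andbF mulr0.
Qed.

(* Averaging over [G] is a projection onto the line of [rG x]: multiplied by
   [rG x^-1%g], the sum commutes with [G], so it is scalar by Schur's lemma. *)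
Lemma isotypic_projection (x : gT) (chi : gT -> F) (M : 'M[F]_n) :
    x \in G ->
    {in G, forall y, rG y *m rG x = chi y *: (rG x *m rG y)} ->
  n%:R *: \sum_(y in G) (chi y)^-1 *: (rG y *m M *m rG y^-1%g)
    = (#|G|%:R * \tr (M *m rG x^-1%g)) *: rG x.
Proof.
move=> Gx chiP; have chi_n0 y : y \in G -> chi y != 0.
  move=> Gy; apply: contraNneq (repr_mx_neq0 abs_irr_dim_gt0 (groupM Gy Gx)) => chi0.
  by rewrite repr_mxM // chiP // chi0 scale0r.
pose N := M *m rG x^-1%g.
pose S := \sum_(y in G) rG y *m N *m rG y^-1%g.
have -> : \sum_(y in G) (chi y)^-1 *: (rG y *m M *m rG y^-1%g) = S *m rG x.
  rewrite mulmx_suml; apply: eq_bigr => y Gy; rewrite /N.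
  have rGyx : rG y^-1%g *m rG x = (chi y)^-1 *: (rG x *m rG y^-1%g).
    have Gy' := groupVr Gy.
    have : rG y^-1%g *m (rG y *m rG x) *m rG y^-1%g =
           chi y *: (rG y^-1%g *m (rG x *m rG y) *m rG y^-1%g).
      by rewrite chiP // -scalemxAr -scalemxAl.
    rewrite !mulmxA -(repr_mxM rG Gy' Gy) mulVg repr_mx1 mul1mx.
    by rewrite repr_mxK // => ->; rewrite scalerA mulVf ?scale1r ?chi_n0.
  rewrite !mulmxA -(mulmxA _ _ (rG x)) rGyx -scalemxAr; congr (_ *: _).
  by rewrite !mulmxA repr_mxKV.
have [s Ss] : exists s, S = s%:M.
  apply/is_scalar_mxP/(mx_abs_irr_cent_scalar absG)/centgmxP=> z Gz.
  rewrite mulmx_suml mulmx_sumr (reindex_inj (mulgI z)) /=.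
  apply: eq_big => y; first by rewrite groupMl.
  rewrite groupMl // => Gy; rewrite invMg !repr_mxM ?groupV //.
  by rewrite !mulmxA repr_mxKV.
have: \tr S = \sum_(y in G) \tr N.
  rewrite linear_sum; apply: eq_bigr => y Gy /=.
  by rewrite mxtrace_mulC mulmxA -repr_mxM ?groupV // mulVg repr_mx1 mul1mx.
rewrite sumr_const Ss mxtrace_scalar mul_scalar_mx scalerA => trS.
by rewrite mulr_natl trS mulr_natl.
Qed.

End Representation.

(** * From the general to the special linear group *)

Section Normalizer.

Context {F : numClosedFieldType} {n : nat}.
Variable K : set 'M[F]_n.

Definition GL : set 'M[F]_n := fun g => g \in unitmx.

Lemma Ad_scale (c : F) (g M : 'M[F]_n) : c != 0 -> g \in unitmx ->
  Ad (c *: g) M = Ad g M.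
Proof.
move=> c0 Ug; rewrite /Ad invmxZ ?unitmxZ ?unitfE //.
by rewrite -!scalemxAl -scalemxAr scalerA divff ?scale1r.
Qed.

(** An [n]-th root of [(\det g)^-1] exists in an algebraically closed field, and a nonzero scalar
    factor does not change the conjugation. *)
Lemma normalizer_GL_to_SL (g : 'M[F]_n) : (0 < n)%N -> normalizer_in GL K g ->
  exists2 h, normalizer_in (SL F n) K h & Ad h =1 Ad g.
Proof.
move=> n_gt0 [Ug nKg]; have det0 : \det g != 0.
  by move: Ug; rewrite /GL unitmxE unitfE.
pose c := n.-root (\det g)^-1.
have cn : c ^+ n = (\det g)^-1 by rewrite rootCK.
have c0 : c != 0 by have := expf_eq0 c n; rewrite n_gt0 cn invr_eq0 => /= <-.
have AdE : Ad (c *: g) =1 Ad g by move=> M; apply: Ad_scale.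
exists (c *: g) => //; split; last by rewrite (funext AdE).
by rewrite /SL /= detZ cn mulVf.
Qed.

Lemma Ad_trace (g M : 'M[F]_n) : g \in unitmx -> \tr (Ad g M) = \tr M.
Proof. by move=> Ug; rewrite /Ad mxtrace_mulC mulmxA mulVmx ?mul1mx. Qed.

End Normalizer.

(** * Commutators and traces of noncentral elements *)

Section Extraspecial.

Context {F : numClosedFieldType} {gT : finGroupType} {G : {group gT}} {n : nat}.
Context {rG : mx_representation F G n} {p : nat}.
Hypotheses (absG : mx_absolutely_irreducible rG) (injG : mx_faithful rG).
Hypotheses (p_pr : prime p) (p_ge3 : (3 <= p)%N).
Hypotheses (sGZ : (G^`(1) \subset 'Z(G))%g) (oZ : #|'Z(G)%g| = p).
Hypothesis expG : {in G, forall x, x ^+ p = 1}%g.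

Let n_gt0 : (0 < n)%N := abs_irr_dim_gt0 absG.

Lemma comm_center x y : x \in G -> y \in G -> [~ x, y]%g \in 'Z(G)%g.
Proof. by move=> Gx Gy; rewrite (fintype.subsetP sGZ) ?mem_commg. Qed.

Lemma repr_mulC_scalar x y c : x \in G -> y \in G -> rG [~ x, y]%g = c%:M ->
  rG x *m rG y = c *: (rG y *m rG x).
Proof.
move=> Gx Gy rGc; rewrite -!repr_mxM // commgC.
rewrite (repr_mxM rG (groupM Gy Gx) (groupR Gx Gy)).
by rewrite rGc mul_mx_scalar.
Qed.

Lemma noncentralP x : x \in G -> x \notin 'Z(G)%g ->
  exists2 y, y \in G & [~ x, y]%g != 1%g.
Proof.
move=> Gx; rewrite inE Gx /= => /centP nZx.
apply/exists_inP; apply: contra_notT nZx => /exists_inPn/= cxG y Gy.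
by apply/commgP; have := cxG y Gy; rewrite negbK.
Qed.

(** Conjugation by a suitable [rG x] multiplies [rG y] by a scalar, different from 1 by
    faithfulness, yet preserves its trace. *)
Lemma trace_noncentral y : y \in G -> y \notin 'Z(G)%g -> \tr (rG y) = 0.
Proof.
move=> Gy nZy; have [x Gx nyx] := noncentralP Gy nZy.
have nxy : [~ x, y]%g != 1%g.
  by apply: contra nyx => /commgP cxy; apply/commgP/commute_sym.
have [c rGc] := center_repr_scalar absG (comm_center Gx Gy).
have c1 : c != 1.
  apply: contra nxy => /eqP c1; apply/eqP.
  by apply: (mx_faithful_inj injG); rewrite ?groupR // rGc c1 repr_mx1.
have : \tr (rG x *m rG y *m rG x^-1%g) = c * \tr (rG y).
  rewrite (repr_mulC_scalar (c := c)) // -scalemxAl mxtraceZ -mulmxA.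
  by rewrite -repr_mxM ?groupV // mulgV repr_mx1 mulmx1.
rewrite -mulmxA mxtrace_mulC -mulmxA -repr_mxM ?groupV // mulVg repr_mx1 mulmx1.
move/eqP; rewrite -subr_eq0 -{1}[\tr _]mul1r -mulrBl mulf_eq0 subr_eq0.
by rewrite eq_sym (negPf c1) => /eqP.
Qed.

(** * Gauss sums acting as transvections *)

Section Transvection.

Variables x u : gT.
Hypotheses (Gx : x \in G) (Gu : u \in G).
Let z := [~ x, u]%g.
Hypothesis z_neq1 : z != 1%g.

Let Zz : z \in 'Z(G)%g := comm_center Gx Gu.
Let Gz : z \in G := fintype.subsetP (center_sub G) z Zz.
Let cz i y : y \in G -> commute (z ^+ i)%g y.
Proof. by move=> Gy; apply/commute_sym/commuteX/commute_sym; case/centerP: Zz => _; apply. Qed.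

(* [g k] is a Gauss-sum coefficient times [u ^+ k]: the exponent [k choose 2]
   makes [g j * y * g k = g (j + k) * y] whenever [[y, u] = z ^+ j]. *)
Let g k : gT := (z ^+ 'C(k, 2) * u ^+ k)%g.
Definition transvection : 'M[F]_n := \sum_(k < p) rG (g k).
Let T := transvection.

Let Gg k : g k \in G. Proof. by rewrite groupM ?groupX. Qed.

Let zp : (z ^+ p = 1)%g. Proof. exact: expG. Qed.

Let g_periodic k : g (k + p)%N = g k.
Proof.
have /dvdnP[q Dq] := prime_dvd_bin2 p_pr p_ge3.
rewrite /g bin2D Dq -addnA -mulnDl 2!expgD mulnC !expgM zp !expg1n.
by rewrite mulg1 (expG Gu) ?mulg1.
Qed.

(** A nontrivial [z] generates the center, which has prime order and contains all commutators. *)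
Let comm_u_exponent y : y \in G -> exists j, (y * u = u * y * z ^+ j)%g.
Proof.
move=> Gy; have : [~ y, u]%g \in <[z]>%g.
  have -> : <[z]>%g = 'Z(G)%g; last exact: comm_center.
  apply/eqP; rewrite eqEcard cycle_subG Zz oZ -orderE /=.
  have : (#[z]%g %| p)%N by rewrite order_dvdn zp.
  by move/(prime_nt_dvdP p_pr) => -> //; rewrite order_eq1.
by case/cycleP=> j Dj; exists j; rewrite -Dj -commgC.
Qed.

Let comm_uX y i j : y \in G -> (y * u = u * y * z ^+ j)%g ->
  (y * u ^+ i = u ^+ i * y * z ^+ (i * j))%g.
Proof.
move=> Gy yu; elim: i => [|i IHi]; first by rewrite mul0n !expg0 !mulg1 mul1g.
rewrite expgSr mulgA IHi -!mulgA (cz _ Gu) (mulgA y) yu.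
by rewrite mulSn expgD !mulgA.
Qed.

Let g_mul y j k : y \in G -> (y * u = u * y * z ^+ j)%g ->
  (g j * y * g k = g (k + j) * y)%g.
Proof.
move=> Gy yu; rewrite /g.
transitivity (z ^+ 'C(j, 2) * (u ^+ j * y * z ^+ 'C(k, 2)) * u ^+ k)%g.
  by rewrite !mulgA.
rewrite -cz ?groupM ?groupX //.
transitivity (z ^+ 'C(j, 2) * z ^+ 'C(k, 2) * u ^+ j * (y * u ^+ k))%g.
  by rewrite !mulgA.
rewrite (comm_uX _ Gy yu).
transitivity (z ^+ 'C(j, 2) * z ^+ 'C(k, 2) * (u ^+ j * u ^+ k * y * z ^+ (k * j)))%g.
  by rewrite !mulgA.
rewrite -[X in (_ * X)%g]cz ?groupM ?groupX // -(expgD u) !mulgA -!expgD bin2D.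
have -> : ('C(j, 2) + 'C(k, 2) + k * j = 'C(k, 2) + k * j + 'C(j, 2))%N by lia.
by rewrite [(j + k)%N]addnC.
Qed.

Lemma transvection_mul y j : y \in G -> (y * u = u * y * z ^+ j)%g ->
  T *m rG y = rG (g j * y)%g *m T.
Proof.
move=> Gy yu; rewrite mulmx_sumr.
(* Shifting the index over a full period preserves the sum; the two sides then agree termwise by
   [g_mul]. *)
have <- : \sum_(k < p) rG (g (k + j)) = T.
  by apply: (sum_shift_periodic (f := fun k => rG (g k))) => k; rewrite g_periodic.
rewrite mulmx_suml; apply: eq_bigr => k _.
by rewrite -(repr_mxM rG (Gg _) Gy) -(repr_mxM rG (groupM (Gg j) Gy) (Gg k)) g_mul.
Qed.

Lemma transvection_mul_self : T *m rG x = rG (u * x)%g *m T.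
Proof.
rewrite (transvection_mul (j := 1)) // ?expg1 -?commgC //.
by rewrite /g bin_small // expg0 mul1g expg1.
Qed.

Lemma transvection_unit : T \in unitmx.
Proof.
have /mx_irrP[_ irrG] := mx_abs_irrW absG.
rewrite -row_full_unit irrG //.
  apply/mxmoduleP=> y Gy; have [j yu] := comm_u_exponent Gy.
  by rewrite (transvection_mul (y := y) (j := j)) // submxMl.
suff : \tr T != 0 by apply: contraNneq => ->; rewrite mxtrace0.
(* Only the term [k = 0] contributes to the trace: [g 0 = 1] gives [n], and the other [g k] are
   noncentral. *)
rewrite linear_sum /=; case: p p_pr zp => // q q_pr zq.
rewrite big_ord_recl /= big1 ?addr0 => [|k _].
  by rewrite /g bin0n !expg0 mulg1 repr_mx1 mxtrace1 pnatr_eq0 -lt0n.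
apply: trace_noncentral => //; apply/negP=> /centerP[_ /(_ x Gx) cgx].
(* Moving [x] past [u ^+ k.+1] produces the factor [z ^+ k.+1], nontrivial because [k.+1] is below
   the order [q.+1] of [z]. *)
have zk : (z ^+ k.+1 = 1)%g.
  apply: (mulgI (g k.+1 * x)%g); rewrite mulg1 [RHS]cgx /g.
  rewrite (mulgA x) -(cz _ Gx) -!mulgA; congr (_ * _)%g.
  have xu : (x * u = u * x * z ^+ 1)%g by rewrite expg1 -commgC.
  by rewrite (comm_uX _ Gx xu) muln1 mulgA.
have : (#[z]%g %| q.+1)%N by rewrite order_dvdn zq.
move/(prime_nt_dvdP q_pr) => oz; have := order_dvdn z k.+1.
rewrite oz ?order_eq1 // zk eqxx => /dvdn_leq-/(_ isT).
by rewrite ltnS leqNgt ltn_ord.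
Qed.

Lemma transvection_norm : normalizer_in GL (repr_image rG) T.
Proof.
have AdT y j : y \in G -> (y * u = u * y * z ^+ j)%g -> Ad T (rG y) = rG (g j * y)%g.
  move=> Gy yu; rewrite /Ad (transvection_mul (y := y) (j := j)) // mulmxK //.
  exact: transvection_unit.
split; first exact: transvection_unit.
rewrite predeqE => M; split=> [[_ [y Gy ->] <-] | [y Gy ->]].
  have [j yu] := comm_u_exponent Gy.
  by exists (g j * y)%g; [rewrite groupM | exact: AdT].
have [j yu] := comm_u_exponent Gy.
(* Since [g j] commutes with [u], this preimage has the same exponent [j] as [y]. *)
exists (rG ((g j)^-1 * y)%g); first by exists ((g j)^-1 * y)%g; rewrite ?groupM ?groupV.
rewrite (AdT _ j) ?mulKVg ?groupM ?groupV //.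
have cgu : commute (g j)^-1%g u.
  by apply/commute_sym/commuteV/commuteM; [apply/commute_sym/cz | apply: commuteX].
by rewrite -mulgA yu !mulgA cgu.
Qed.

End Transvection.

(** * Transitivity on noncentral elements *)

Lemma Ad_transvection x y : x \in G -> y \in G -> [~ x, y]%g != 1%g ->
  exists2 T, normalizer_in GL (repr_image rG) T & Ad T (rG x) = rG y.
Proof.
(* The direction [u = y * x^-1] is chosen so that [u * x = y]. *)
move=> Gx Gy nxy; have Gu : (y * x^-1)%g \in G by rewrite groupM ?groupV.
have nxu : [~ x, y * x^-1]%g != 1%g.
  apply: contra nxy => /commgP cxu; apply/commgP.
  by rewrite -[y](mulgVK x); apply: commuteM.
exists (transvection x (y * x^-1)%g); first exact: transvection_norm.
rewrite /Ad transvection_mul_self ?mulgVK ?mulmxK //.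
exact: transvection_unit.
Qed.

(* A group is not the union of two proper subgroups, here the centralizers of
   [x] and [y]. *)
Lemma noncentral_link x y : x \in G -> y \in G ->
    x \notin 'Z(G)%g -> y \notin 'Z(G)%g ->
  exists w, [/\ w \in G, [~ x, w]%g != 1%g & [~ w, y]%g != 1%g].
Proof.
move=> Gx Gy nZx nZy.
have [a Ga nxa] := noncentralP Gx nZx; have [b Gb nyb] := noncentralP Gy nZy.
have {}nyb : [~ b, y]%g != 1%g.
  by apply: contra nyb => /commgP cby; apply/commgP/commute_sym.
have [cay | ] := eqVneq [~ a, y]%g 1%g; last by exists a.
have [cxb | ] := eqVneq [~ x, b]%g 1%g; last by exists b.
move/eqP/commgP in cay; move/eqP/commgP in cxb.
exists (a * b)%g; split; first exact: groupM.
  apply: contra nxa => /commgP cxab; apply/commgP.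
  by rewrite -[a](mulgK b); apply: commuteM => //; apply: commuteV.
apply: contra nyb => /commgP caby; apply/commgP/commute_sym.
rewrite -[b](mulKg a); apply: commuteM; last exact: commute_sym.
exact/commuteV/commute_sym.
Qed.

(** * Subspaces stable under the normalizer *)

Section StableSubspace.

Variable W : {vspace 'M[F]_n}.
Hypothesis nW : Defs.stable (normalizer_in (SL F n) (repr_image rG)) (@Ad F n) W.

Lemma stable_GL g M : normalizer_in GL (repr_image rG) g -> M \in W -> Ad g M \in W.
Proof.
by move=> /(normalizer_GL_to_SL n_gt0)[h nKh <-] WM; apply: nW.
Qed.

Lemma repr_norm y : y \in G -> normalizer_in GL (repr_image rG) (rG y).
Proof.
move=> Gy; have AdE x : x \in G -> Ad (rG y) (rG x) = rG (x ^ y^-1)%g.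
  by move=> Gx; rewrite /Ad -repr_mxV // -!repr_mxM ?groupM ?groupV // conjgE invgK mulgA.
split; first exact: repr_mx_unit.
rewrite predeqE => M; split=> [[_ [x Gx ->] <-] | [x Gx ->]].
  by exists (x ^ y^-1)%g; [rewrite groupJ ?groupV | exact: AdE].
exists (rG (x ^ y)%g); first by exists (x ^ y)%g; rewrite ?groupJ.
by rewrite AdE ?groupJ // conjgK.
Qed.

(** The isotypic projection of [M] is a weighted sum of conjugates of [M], so it stays in [W]; up to
    a nonzero factor it is [rG x]. *)
Lemma stable_repr_mem M x : x \in G -> M \in W -> \tr (M *m rG x^-1%g) != 0 ->
  rG x \in W.
Proof.
(* Commutators act by scalars, so a diagonal entry gives the scalar. *)
move=> Gx WM trM; pose chi y := rG [~ y, x]%g (Ordinal n_gt0) (Ordinal n_gt0).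
have chiP : {in G, forall y, rG y *m rG x = chi y *: (rG x *m rG y)}.
  move=> y Gy; have [c rGc] := center_repr_scalar absG (comm_center Gy Gx).
  by rewrite (repr_mulC_scalar Gy Gx rGc) /chi rGc mxE eqxx.
have := isotypic_projection absG M Gx chiP.
set S := \sum_(y in G) _ => DS.
have WS : S \in W.
  apply: memv_suml => y Gy; apply: memvZ; rewrite repr_mxV //.
  exact: (stable_GL (repr_norm Gy)).
have c_neq0 : #|G|%:R * \tr (M *m rG x^-1%g) != 0.
  by rewrite mulf_neq0 // pnatr_eq0 -lt0n cardG_gt0.
have -> : rG x = (#|G|%:R * \tr (M *m rG x^-1%g))^-1 *: (n%:R *: S).
  by rewrite DS scalerA mulVf ?scale1r.
by rewrite !memvZ.
Qed.

Lemma stable_noncentral x y : x \in G -> y \in G ->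
  x \notin 'Z(G)%g -> y \notin 'Z(G)%g -> rG x \in W -> rG y \in W.
Proof.
move=> Gx Gy nZx nZy Wx.
have [w [Gw nxw nwy]] := noncentral_link Gx Gy nZx nZy.
have [S nS <-] := Ad_transvection Gw Gy nwy; apply: (stable_GL nS).
by have [T nT <-] := Ad_transvection Gx Gw nxw; apply: (stable_GL nT).
Qed.

Lemma stable_sl_sub M : M \in W -> M != 0 -> \tr M = 0 -> (sl F n <= W)%VS.
Proof.
move=> WM M_neq0 trM.
have [x Gx trMx] : exists2 x, x \in G & \tr (M *m rG x) != 0.
  apply/exists_inP; apply: contraNT M_neq0 => /exists_inPn/= trM0.
  by apply/eqP/(abs_irr_trace_eq0 absG) => x Gx; apply/eqP/negPn/trM0.
have nZx : x \notin 'Z(G)%g.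
  apply: contra trMx => /(center_repr_scalar absG)[c ->].
  by rewrite mul_mx_scalar mxtraceZ trM mulr0.
have Wx : rG x^-1%g \in W.
  by apply: stable_repr_mem WM _; rewrite ?groupV // invgK.
have Wnc y : y \in G -> y \notin 'Z(G)%g -> rG y \in W.
  by move=> Gy nZy; apply: stable_noncentral Wx; rewrite ?groupV.
apply/subvP=> N; rewrite mem_sl => /eqP trN.
have [_ [a aP]] := mx_abs_irrP absG.
(* The central terms of the expansion of [N] add up to a scalar matrix and the others have trace
   zero, so [\tr N = 0] forces [c = 0]. *)
have [c Dc] : exists c, \sum_(y in G | y \in 'Z(G)%g) a y N *: rG y = c%:M.
  apply: (big_ind (fun A : 'M[F]_n => exists c, A = c%:M)) => [|A B [c ->] [d ->]|y].
  - by exists 0; rewrite raddf0.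
  - by exists (c + d); rewrite raddfD.
  case/andP=> _ /(center_repr_scalar absG)[c ->].
  by exists (a y N * c); rewrite scale_scalar_mx.
have DN := aP N; rewrite (bigID (mem 'Z(G)%g)) /= Dc in DN.
set S := \sum_(y in G | _) _ in DN.
have trS : \tr S = 0.
  rewrite linear_sum big1 //= => y /andP[Gy nZy].
  by rewrite mxtraceZ trace_noncentral ?mulr0.
have c0 : c = 0.
  move: trN; rewrite DN mxtraceD trS addr0 mxtrace_scalar => /eqP.
  by rewrite mulrn_eq0 eqn0Ngt n_gt0 => /eqP.
rewrite DN c0 raddf0 add0r; apply: memv_suml => y /andP[Gy nZy].
by rewrite memvZ ?Wnc.
Qed.

End StableSubspace.

(** * Irreducibility of the adjoint action *)

Lemma Ad_irreducible : (1 < n)%N ->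
  irreducible_on (normalizer_in (SL F n) (repr_image rG)) (@Ad F n) (sl F n).
Proof.
move=> n_gt1; split.
- move=> g M [detg _]; rewrite !mem_sl Ad_trace //.
  by rewrite unitmxE detg unitr1.
- move/(congr1 (fun U : {vspace _} => \dim U)); rewrite dim_sl // dimv0 -mulnn.
  by move: n_gt1; nia.
move=> W sWsl nW; have [-> | W_neq0] := eqVneq W 0%VS; [by left | right].
apply/eqP; rewrite eqEsubv sWsl /=.
apply: (stable_sl_sub nW (memv_pick W)); first by rewrite vpick0.
by apply/eqP; rewrite -mem_sl (subvP sWsl) ?memv_pick.
Qed.

End Extraspecial.

Theorem theorem1p1 (R : realType) (p r : nat) (gT : finGroupType)
    (P : {group gT}) (rho : mx_representation R[i] P (p ^ r)) :
  prime p -> (3 <= p)%N -> (0 < r)%N ->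
  extraspecial P -> #|P| = (p ^ (2 * r + 1))%N -> exponent P = p ->
  mx_irreducible rho ->
  mx_faithful rho /\
  irreducible_on (normalizer_in (SL R[i] (p ^ r)) (repr_image rho))
    (@Ad _ _) (sl R[i] (p ^ r)).
Proof.
move=> p_pr p_ge3 r_gt0 esP oP expP irr_rho.
have pP : (p.-group P)%g by rewrite /pgroup oP pnatX pnat_id.
have oZ := card_center_extraspecial pP esP.
have [[_ derZ] _] := esP.
have n_gt1 : (1 < p ^ r)%N by rewrite -(exp1n r) ltn_exp2r // prime_gt1.
have splitP : group_splitting_field R[i] P by apply: group_closure_closed_field.
(* A nontrivial kernel, being normal in a [p]-group, meets the center, hence contains it as its
   order is prime. The center is the derived subgroup, so the degree would be 1. *)
have faith : mx_faithful rho.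
  apply: contraLR n_gt1 => ntK; rewrite -leqNgt leq_eqVlt.
  rewrite -(der1_sub_rker splitP irr_rho) derZ.
  have := meet_center_nil (pgroup_nil pP) (rker_normal rho).
  rewrite /mx_faithful subG1 in ntK => /(_ ntK) ntKZ.
  by rewrite prime_meetG ?oZ // finset.setIC.
split=> //; apply: (Ad_irreducible (p := p)) => //; first exact: splitP.
- by rewrite derZ.
- by move=> x Px; apply/eqP; rewrite -order_dvdn -expP dvdn_exponent.
Qed.
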